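(* Consider the dual hyperbolic conchoidal motion $H/H'$ with parameter $\tilde\psi=\psi+\varepsilon\psi^*$ ($\psi,\psi^*\in\mathbb{R}$), and the orbit drawn on $H'$ by the fixed point $\tilde X$ given by $\tilde x=a(\tilde v_1\sinh P+\tilde v_3\sinh Q)$ in the case $P=p+\varepsilon p^*=0$, so that $\tilde X=\tilde v_3$. Then the Study map of this orbit is the line congruence $$y_3^2-y_2^2=\lambda^2,\qquad y_1=\psi^*,$$ where $\lambda$ is the running parameter along each line. That is, for all $\psi,\psi^*,\lambda\in\mathbb{R}$, the point $y=(y_1,y_2,y_3)$ with parameter $\lambda$ on the line corresponding to $\tilde v_3(\psi+\varepsilon\psi^* )$ satisfies these two equations. Here, writing $\tilde v_3=x+\varepsilon x^*$, the parameter $\lambda$ is defined by $y=x\times x^*+\lambda x$.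
   Context: Minkowski space: $\mathbb{R}^3_1$ is $\mathbb{R}^3$ with $\langle a,b\rangle=a_1b_1+a_2b_2-a_3b_3$ and Lorentzian cross product $a\times b=(a_3b_2-a_2b_3,\ a_1b_3-a_3b_1,\ a_1b_2-a_2b_1)$. A vector $a$ is timelike if $\langle a,a\rangle<0$, and spacelike if $\langle a,a\rangle>0$ or $a=0$. Dual numbers: $\mathbb{D}=\{\lambda+\varepsilon\lambda^*:\lambda,\lambda^*\in\mathbb{R}\}$ with $\varepsilon^2=0$. A differentiable real function $f$ extends by $f(x+\varepsilon x^* )=f(x)+\varepsilon x^*f'(x)$. Dual vectors are $\tilde a=a+\varepsilon a^*$ with $a,a^*\in\mathbb{R}^3_1$; $\langle\cdot,\cdot\rangle$ and $\times$ extend $\mathbb{D}$-bilinearly. The dual vector $\tilde a$ is a unit dual timelike (resp. spacelike) vector if $\langle a,a\rangle=-1$ (resp. $+1$) and $\langle a,a^*\rangle=0$. The dual hyperbolic unit sphere is the set of unit dual timelike vectors. Study map: a unit dual vector $\tilde x=x+\varepsilon x^*$ corresponds to the directed straight line in $\mathbb{R}^3_1$ with direction $x$ and moment $x^*$, i.e. the line $\{m\in\mathbb{R}^3_1: m\times x=x^*\}$. For $x$ timelike this line is $\{x\times x^*+\lambda x:\lambda\in\mathbb{R}\}$. The Study map of a family of unit dual vectors is the corresponding family of lines; a two-parameter family of lines is called a line congruence. Dual hyperbolic conchoidal motion $H/H'$: let $\{0;\tilde u_1,\tilde u_2,\tilde u_3\}$ be the fixed dual orthonormal frame (the standard basis,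 with $\tilde u_3$ timelike), representing the fixed dual hyperbolic unit sphere $H'$. Fix a dual constant $\tilde\Delta=\sigma+\varepsilon\sigma^*$ and the dual point $C$ given by $\tilde c=\tilde u_3\cosh\tilde\Delta+\tilde u_1\sinh\tilde\Delta$. The moving orthonormal frame $\{0;\tilde v_1,\tilde v_2,\tilde v_3\}$, representing the sphere $H$, depends on the dual hyperbolic angle $\tilde\psi=\psi+\varepsilon\psi^*$ by $\tilde v_3=\tilde u_3\cosh\tilde\psi+\tilde u_2\sinh\tilde\psi$, with $\tilde v_1$ a unit dual spacelike vector satisfying $\langle\tilde v_1,\tilde v_3\rangle=0$ and $\det(\tilde v_1,\tilde v_3,\tilde c)=0$ (the plane $\tilde v_1\tilde v_3$ always passes through $C$), and $\tilde v_2=\tilde v_1\times\tilde v_3$. A fixed point $\tilde X$ of $H$ in the plane $\tilde v_1\tilde v_3$ is described by constant dual hyperbolic angles $P=p+\varepsilon p^*$ (between $\tilde v_1$ and $\tilde x$) and $Q=q+\varepsilon q^*$ (between $\tilde x$ and $\tilde v_3$), with $P+Q=\pi/2$ and $a=1/\sinh(P+Q)$, via $\tilde x=a(\tilde v_1\sinh P+\tilde v_3\sinh Q)$; for $P=0$ this gives $\tilde x=\tilde v_3$. *)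

(* Defs.v *)
From Stdlib Require Import Reals.
From Coquelicot Require Import Coquelicot.
Open Scope R_scope.

(* The dual number re + eps * du, with eps^2 = 0. *)
Record dual : Type := Dual { re : R; du : R }.

Definition dzero : dual := Dual 0 0.
Definition dadd (a b : dual) : dual := Dual (re a + re b) (du a + du b).
Definition dmul (a b : dual) : dual :=
  Dual (re a * re b) (re a * du b + du a * re b).

(* Extension of a real function f to dual numbers,
   f (x + eps x') = f x + eps x' f'(x); only meaningful where f is
   differentiable, since [Derive] is total. *)
Definition dext (f : R -> R) (t : dual) : dual :=
  Dual (f (re t)) (du t * Derive f (re t)).

Definition dcosh : dual -> dual := dext cosh.
Definition dsinh : dual -> dual := dext sinh.
Definition dinv : dual -> dual := dext Rinv.

(* Minkowski 3-space, signature (+, +, -). *)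
Record vec : Type := Vec { y1 : R; y2 : R; y3 : R }.

Definition vadd (a b : vec) : vec :=
  Vec (y1 a + y1 b) (y2 a + y2 b) (y3 a + y3 b).
Definition vscal (l : R) (a : vec) : vec :=
  Vec (l * y1 a) (l * y2 a) (l * y3 a).
Definition lorentz (a b : vec) : R :=
  y1 a * y1 b + y2 a * y2 b - y3 a * y3 b.
Definition cross (a b : vec) : vec :=
  Vec (y3 a * y2 b - y2 a * y3 b)
      (y1 a * y3 b - y3 a * y1 b)
      (y1 a * y2 b - y2 a * y1 b).
Definition det3 (a b c : vec) : R :=
  y1 a * (y2 b * y3 c - y3 b * y2 c)
  - y2 a * (y1 b * y3 c - y3 b * y1 c)
  + y3 a * (y1 b * y2 c - y2 b * y1 c).

(* The dual vector dir + eps * mom. *)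
Record dvec : Type := DVec { dir : vec; mom : vec }.

(* Extensions of the above by linearity over the dual numbers. *)
Definition dvadd (a b : dvec) : dvec :=
  DVec (vadd (dir a) (dir b)) (vadd (mom a) (mom b)).
Definition dvscal (l : dual) (a : dvec) : dvec :=
  DVec (vscal (re l) (dir a))
       (vadd (vscal (re l) (mom a)) (vscal (du l) (dir a))).
Definition dlorentz (a b : dvec) : dual :=
  Dual (lorentz (dir a) (dir b))
       (lorentz (dir a) (mom b) + lorentz (mom a) (dir b)).
Definition dcross (a b : dvec) : dvec :=
  DVec (cross (dir a) (dir b))
       (vadd (cross (dir a) (mom b)) (cross (mom a) (dir b))).
Definition ddet (a b c : dvec) : dual :=
  Dual (det3 (dir a) (dir b) (dir c))
       (det3 (mom a) (dir b) (dir c) + det3 (dir a) (mom b) (dir c)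
        + det3 (dir a) (dir b) (mom c)).

Definition unit_dual_timelike (a : dvec) : Prop :=
  lorentz (dir a) (dir a) = -1 /\ lorentz (dir a) (mom a) = 0.
Definition unit_dual_spacelike (a : dvec) : Prop :=
  lorentz (dir a) (dir a) = 1 /\ lorentz (dir a) (mom a) = 0.

Definition dual_hyperbolic_sphere (a : dvec) : Prop := unit_dual_timelike a.

Definition u1 : dvec := DVec (Vec 1 0 0) (Vec 0 0 0).
Definition u2 : dvec := DVec (Vec 0 1 0) (Vec 0 0 0).
Definition u3 : dvec := DVec (Vec 0 0 1) (Vec 0 0 0).

Definition study_line (x : dvec) (m : vec) : Prop :=
  cross m (dir x) = mom x.

(* The point with parameter lam on the line of a timelike x. *)
Definition study_point (x : dvec) (lam : R) : vec :=
  vadd (cross (dir x) (mom x)) (vscal lam (dir x)).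

(* The Study map of a family of dual vectors with one dual, hence two real,
   parameters: the congruence of the corresponding lines. *)
Definition study_map (X : dual -> dvec) (psi psi' : R) : vec -> Prop :=
  study_line (X (Dual psi psi')).

Definition conchoidal_point (Delta : dual) : dvec :=
  dvadd (dvscal (dcosh Delta) u3) (dvscal (dsinh Delta) u1).

(* The motion H/H': v1, v2, v3 is the moving frame as a function of the dual
   angle. The conditions on v1 leave its sign free. *)
Record conchoidal_motion (Delta : dual) (v1 v2 v3 : dual -> dvec) : Prop :=
  ConchoidalMotion {
    motion_v3 : forall t : dual,
      v3 t = dvadd (dvscal (dcosh t) u3) (dvscal (dsinh t) u2);
    motion_v1_unit : forall t : dual, unit_dual_spacelike (v1 t);
    motion_v1_orth : forall t : dual, dlorentz (v1 t) (v3 t) = dzero;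
    motion_v1_plane : forall t : dual,
      ddet (v1 t) (v3 t) (conchoidal_point Delta) = dzero;
    motion_v2 : forall t : dual, v2 t = dcross (v1 t) (v3 t)
  }.

(* Orbit on H' of the point a (v1 sinh P + v3 sinh Q), a = 1 / sinh (P + Q),
   fixed in H. *)
Definition orbit (v1 v3 : dual -> dvec) (P Q : dual) (t : dual) : dvec :=
  dvscal (dinv (dsinh (dadd P Q)))
    (dvadd (dvscal (dsinh P) (v1 t)) (dvscal (dsinh Q) (v3 t))).

(* Main.v *)
Require Import Defs.
From Stdlib Require Import Reals Lra.
From Coquelicot Require Import Coquelicot.
Open Scope R_scope.

(** For [P = 0] the weight [sinh P] of [v1] is the dual number zero, while
    [a = 1 / sinh (P + Q)] is the inverse of the weight [sinh Q] of [v3]: the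
    orbit is [v3] itself ([orbit_at_v3]).

    The lines come from one identity, the Lorentzian triple product
    [x * (m * x) = -<x,x> m + <m,x> x].  For a unit timelike [x] it recovers a
    point [m] of the line from the moment [m * x], with parameter [-<m,x>], and
    it shows that every [x * x' + lam x] has the moment [x']
    ([study_line_param]).

    Since [cosh' = sinh] and [sinh' = cosh], the dual vector
    [cosh t u3 + sinh t u2] has direction [(0, sinh psi, cosh psi)] and moment
    [psi'] times the derivative of that direction.  The cross product of the
    two is [psi' (cosh^2 - sinh^2)] along the first axis, so the point with
    parameter [lam] is [(psi', lam sinh psi, lam cosh psi)]
    ([study_point_hyperbolic]).  The equations of the congruence are then
    [cosh^2 - sinh^2 = 1]. *)

Lemma Derive_cosh (x : R) : Derive cosh x = sinh x.
Proof. apply is_derive_unique, is_derive_Reals, derivable_pt_lim_cosh. Qed.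

Lemma Derive_sinh (x : R) : Derive sinh x = cosh x.
Proof. apply is_derive_unique, is_derive_Reals, derivable_pt_lim_sinh. Qed.

Lemma cosh2_sub_sinh2 (x : R) : cosh x ^ 2 - sinh x ^ 2 = 1.
Proof.
unfold cosh, sinh; rewrite exp_Ropp; field.
apply Rgt_not_eq, exp_pos.
Qed.

Lemma sinh_pos (x : R) : 0 < x -> 0 < sinh x.
Proof. intros Hx; rewrite <- sinh_0; now apply sinh_lt. Qed.

Lemma dmul_dinv (s : dual) : re s <> 0 -> dmul (dinv s) s = Dual 1 0.
Proof.
intros Hs.
assert (HD : Derive Rinv (re s) = - / re s ^ 2).
{ apply is_derive_unique; auto_derive; [exact Hs | now field]. }
unfold dmul, dinv, dext; simpl; rewrite HD; f_equal; now field.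
Qed.

Lemma dvscal_dvscal (a b : dual) (x : dvec) :
  dvscal a (dvscal b x) = dvscal (dmul a b) x.
Proof.
unfold dvscal, dmul, vscal, vadd; simpl; f_equal; f_equal; ring.
Qed.

Lemma dvscal_one (x : dvec) : dvscal (Dual 1 0) x = x.
Proof.
destruct x as [[a b c] [a' b' c']].
unfold dvscal, vscal, vadd; simpl; f_equal; f_equal; ring.
Qed.

Lemma dvscal_zero_add (x y : dvec) : dvadd (dvscal dzero x) y = y.
Proof.
destruct y as [[a b c] [a' b' c']].
unfold dvadd, dvscal, vscal, vadd; simpl; f_equal; f_equal; ring.
Qed.

Lemma dadd_zero_l (a : dual) : dadd dzero a = a.
Proof. destruct a; unfold dadd; simpl; f_equal; ring. Qed.

Lemma dsinh_zero : dsinh dzero = dzero.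
Proof.
unfold dsinh, dext, dzero; simpl; rewrite sinh_0, Rmult_0_l; reflexivity.
Qed.

Lemma orbit_at_v3 (v1 v3 : dual -> dvec) (Q t : dual) :
  sinh (re Q) <> 0 -> orbit v1 v3 dzero Q t = v3 t.
Proof.
intros HQ; unfold orbit.
rewrite dadd_zero_l, dsinh_zero, dvscal_zero_add, dvscal_dvscal.
rewrite dmul_dinv; [apply dvscal_one | exact HQ].
Qed.

(** The signs differ from the Euclidean triple product: [cross] is the
    Euclidean product with its first two components negated. *)
Lemma cross_cross (x m : vec) :
  cross x (cross m x) =
  vadd (vscal (- lorentz x x) m) (vscal (lorentz m x) x).
Proof.
unfold cross, vadd, vscal, lorentz; simpl; f_equal; ring.
Qed.

(** The moment of the point with parameter [lam] does not depend on [lam], as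
    [x * x = 0]; anticommuting twice turns it into a triple product. *)
Lemma cross_study_point (x : dvec) (lam : R) :
  cross (study_point x lam) (dir x) = cross (dir x) (cross (mom x) (dir x)).
Proof.
unfold study_point, cross, vadd, vscal; simpl; f_equal; ring.
Qed.

(** Since [-<x,x> = 1], the triple product identity can be solved for its
    second vector: a point [m] of the line satisfies [m = x * x' - <m,x> x],
    and the moment [x'], being orthogonal to [x], satisfies
    [x * (x' * x) = x'].  The two facts give the two implications. *)
Lemma study_line_param (x : dvec) (m : vec) :
  unit_dual_timelike x ->
  study_line x m <-> exists lam : R, m = study_point x lam.
Proof.
intros [Hxx Hxm]; unfold study_line; split.
- intros Hm; exists (- lorentz m (dir x)).
  unfold study_point; rewrite <- Hm, cross_cross, Hxx.
  destruct m; unfold vadd, vscal; simpl; f_equal; ring.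
- intros [lam ->].
  assert (Hmx : lorentz (mom x) (dir x) = 0).
  { rewrite <- Hxm; unfold lorentz; ring. }
  rewrite cross_study_point, cross_cross, Hxx, Hmx.
  destruct (mom x); unfold vadd, vscal; simpl; f_equal; ring.
Qed.

(** The moment is the derivative of the direction times [psi'], because a
    function extends to dual numbers by its first-order expansion. *)
Lemma hyperbolic_dvec_coords (psi psi' : R) :
  dvadd (dvscal (dcosh (Dual psi psi')) u3)
    (dvscal (dsinh (Dual psi psi')) u2) =
  DVec (Vec 0 (sinh psi) (cosh psi))
    (Vec 0 (psi' * cosh psi) (psi' * sinh psi)).
Proof.
unfold dcosh, dsinh, dext; simpl; rewrite Derive_cosh, Derive_sinh.
unfold dvadd, dvscal, vadd, vscal; simpl; f_equal; f_equal; ring.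
Qed.

Lemma hyperbolic_dvec_timelike (t : dual) :
  unit_dual_timelike (dvadd (dvscal (dcosh t) u3) (dvscal (dsinh t) u2)).
Proof.
destruct t as [psi psi']; rewrite hyperbolic_dvec_coords.
pose proof (cosh2_sub_sinh2 psi).
unfold unit_dual_timelike, lorentz; simpl; split; [lra | ring].
Qed.

Lemma study_point_hyperbolic (psi psi' lam : R) :
  study_point
    (dvadd (dvscal (dcosh (Dual psi psi')) u3)
       (dvscal (dsinh (Dual psi psi')) u2)) lam =
  Vec psi' (lam * sinh psi) (lam * cosh psi).
Proof.
rewrite hyperbolic_dvec_coords.
unfold study_point, cross, vadd, vscal; simpl; f_equal; try ring.
transitivity (psi' * (cosh psi ^ 2 - sinh psi ^ 2)); [ring |].
rewrite cosh2_sub_sinh2; ring.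
Qed.

Theorem theorem3p2 :
  forall (Delta : dual) (v1 v2 v3 : dual -> dvec),
  conchoidal_motion Delta v1 v2 v3 ->
  forall P Q : dual,
  dadd P Q = Dual (PI / 2) 0 ->
  P = dzero ->
  (forall t : dual,
     orbit v1 v3 P Q t = v3 t /\ dual_hyperbolic_sphere (orbit v1 v3 P Q t)) /\
  (forall psi psi' : R,
     (forall y : vec,
        study_map (orbit v1 v3 P Q) psi psi' y <->
        exists lam : R, y = study_point (v3 (Dual psi psi')) lam) /\
     (forall (lam : R) (y : vec),
        y = study_point (v3 (Dual psi psi')) lam ->
        y3 y ^ 2 - y2 y ^ 2 = lam ^ 2 /\ y1 y = psi')).
Proof.
intros Delta v1 v2 v3 Hmotion P Q HPQ ->.
rewrite dadd_zero_l in HPQ; subst Q.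
assert (Hv3 := motion_v3 _ _ _ _ Hmotion).
assert (Horbit : forall t, orbit v1 v3 dzero (Dual (PI / 2) 0) t = v3 t).
{ intros t; apply orbit_at_v3, Rgt_not_eq, sinh_pos; simpl.
  pose proof PI_RGT_0; lra. }
assert (Hunit : forall t, unit_dual_timelike (v3 t)).
{ intros t; rewrite Hv3; apply hyperbolic_dvec_timelike. }
split.
- intros t; rewrite Horbit; split; [reflexivity | apply Hunit].
- intros psi psi'; split.
  + intros y; unfold study_map; rewrite Horbit.
    apply study_line_param, Hunit.
  + intros lam y ->; rewrite Hv3, study_point_hyperbolic; simpl y1; simpl y2.
    simpl y3; split; [| reflexivity].
    transitivity (lam ^ 2 * (cosh psi ^ 2 - sinh psi ^ 2)); [ring |].
    rewrite cosh2_sub_sinh2; ring.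
Qed.
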